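(* Let $f=x_1^3x_3+x_1^3x_2+x_2^2x_3^2$ and $g=x_1x_3+x_2x_3+x_1x_2$ in $\mathbb{R}[x_1,x_2,x_3]$. Then: (1) there is a point $x'\in\mathbb{R}^3$ with $g(x')>0$; (2) $S(g)\subseteq S(f)$; (3) there is no non-negative homogeneous polynomial $t\in\mathbb{R}[x_1,x_2,x_3]$ of degree at most $2$ such that $f(y)-t(y)g(y)\geq 0$ for all $y\in\mathbb{R}^3$.
   Context: For a polynomial $h\in\mathbb{R}[x_1,\ldots,x_n]$, $S(h)=\{x\in\mathbb{R}^n: h(x)\geq 0\}$. A polynomial $h$ is called non-negative if $h(x)\geq 0$ for all $x\in\mathbb{R}^n$. The zero polynomial counts as a homogeneous polynomial. *)

(* Defs.v *)
From mathcomp Require Import all_boot all_order all_algebra.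
From mathcomp Require Import classical_sets reals.
From mathcomp Require Import mpoly.

Set Implicit Arguments.
Unset Strict Implicit.
Unset Printing Implicit Defensive.

Import Order.TTheory GRing.Theory Num.Theory.

Local Open Scope ring_scope.
Local Open Scope classical_set_scope.

(* Points of R^n are functions 'I_n -> R, the valuations expected by meval. *)
Definition nonneg_set (R : realType) (n : nat) (h : {mpoly R[n]}) :
  set ('I_n -> R) := [set x | 0 <= h.@[x]].

Definition nonneg_poly (R : realType) (n : nat) (h : {mpoly R[n]}) : Prop :=
  forall x : 'I_n -> R, 0 <= h.@[x].

(* Variables are indexed from 0, so x_1, x_2, x_3 are 'X_0, 'X_1, 'X_2. *)
Definition f (R : realType) : {mpoly R[3]} :=
  'X_0 ^+ 3 * 'X_2 + 'X_0 ^+ 3 * 'X_1 + 'X_1 ^+ 2 * 'X_2 ^+ 2.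

Definition g (R : realType) : {mpoly R[3]} :=
  'X_0 * 'X_2 + 'X_1 * 'X_2 + 'X_0 * 'X_1.

(* Main.v *)
Require Import Defs.
From mathcomp Require Import all_boot all_order all_algebra.
From mathcomp Require Import classical_sets reals.
From mathcomp Require Import mpoly.
From mathcomp Require Import ring lra.

(** Put s = x_2 + x_3 and p = x_2 x_3, so that f = x_1^3 s + p^2 and
    g = x_1 s + p.  If g >= 0 and x_1 s < 0, then p >= -x_1 s > 0, and
    s^2 >= 4 p gives (x_1 s)^2 >= 4 p x_1^2; both bounds together force
    f >= 0 ([f_ge0_of_g_ge0]).

    For the third part, let t be non-negative with f - t g >= 0.  Where
    g < 0 < -f this bounds t from below: t(-1,1,1) >= 1.  Where g > 0 it
    bounds t from above: t(2,1,1) <= 17/5, and t(e,1,e) = O(e) as e tends to 0,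
    so that t vanishes at (0,1,0), and by symmetry at (0,0,1).  If t is a
    quadratic form, a zero of t lies in its radical ([zero_in_radical]), whence
    t(x,y,z) = t(1,0,0) x^2.  Then t(1,0,0) = t(-1,1,1) >= 1, although
    4 t(1,0,0) = t(2,1,1) <= 17/5.  A linear form cannot be both non-negative
    and non-zero, and a constant t >= 1 violates the upper bound 7/20 at
    (1/2,1,1/2). *)

Set Implicit Arguments.
Unset Strict Implicit.
Unset Printing Implicit Defensive.

Import Order.TTheory GRing.Theory Num.Theory.

Local Open Scope ring_scope.
Local Open Scope classical_set_scope.

(** * Values of homogeneous polynomials *)

Lemma dhomog_eval_scale (R : comNzRingType) (n d : nat) (t : {mpoly R[n]})
    (c : R) (v : 'I_n -> R) :
  t \is d.-homog -> t.@[fun i => c * v i] = c ^+ d * t.@[v].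
Proof.
move=> /dhomogP homt; rewrite !mevalE mulr_sumr.
rewrite big_seq [RHS]big_seq; apply: eq_bigr => m /homt /= <-.
rewrite mulrCA; congr (_ * _).
under eq_bigr do rewrite exprMn.
by rewrite big_split /= prodrXr mdegE.
Qed.

(** It suffices to treat the monomials, and one of degree 2 is a product of
    two variables, for which the cross term is u_i v_j + v_i u_j. *)
Lemma dhomog2_eval_plane (R : comNzRingType) (n : nat) (t : {mpoly R[n]})
    (u v : 'I_n -> R) :
  t \is 2.-homog ->
  exists b, forall a c,
    t.@[fun i => a * u i + c * v i]
      = a ^+ 2 * t.@[u] + a * c * b + c ^+ 2 * t.@[v].
Proof.
move=> /dhomogP homt; rewrite (mpolyE t) big_seq.
elim/big_ind: _ => [|p q [b pE] [b' qE]|m /homt /= dm].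
- by exists 0 => a c; rewrite !meval0; ring.
- by exists (b + b') => a c; rewrite !mevalD pE qE; ring.
have [i [j ->]] : exists i j, m = (U_(i) + U_(j))%MM.
  have [i mi] : exists i, m i != 0%N.
    apply/existsP; apply: contra_eqT dm => /existsPn m0.
    by rewrite mdegE big1 // => i _; apply/eqP; move: (m0 i); rewrite negbK.
  have le_im : (U_(i) <= m)%MM by rewrite lep1mP.
  have /mdeg1P[j /eqP mB] : mdeg (m - U_(i))%MM == 1%N.
    by move: dm; rewrite -{1}(submK le_im) mdegD mdeg1 addn1 => -[->].
  by exists i, j; rewrite -(submK le_im) mB addmC.
exists (t@_(U_(i) + U_(j)) * (u i * v j + v i * u j)) => a c.
by rewrite !mevalZ mpolyXD !mevalM !mevalXU; ring.
Qed.

(** Along the line through u with direction v, the quadratic form is affine,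
    and a non-negative affine function is constant. *)
Lemma zero_in_radical (R : realType) (n : nat) (t : {mpoly R[n]})
    (u v : 'I_n -> R) (c : R) :
  t \is 2.-homog -> nonneg_poly t -> t.@[v] = 0 ->
  t.@[fun i => u i + c * v i] = t.@[u].
Proof.
move=> homt t_ge0 tv0; have [b tE] := dhomog2_eval_plane u v homt.
have lineE l : t.@[fun i => u i + l * v i] = t.@[u] + l * b.
  rewrite -(@meval_eq _ _ (fun i => 1 * u i + l * v i)) => [|i].
    by rewrite tE tv0; ring.
  by rewrite mul1r.
suff b0 : b = 0 by rewrite lineE b0 mulr0 addr0.
apply/eqP/negPn/negP => b_neq0.
(* The affine function takes the value -1 at this point of the line. *)
have := t_ge0 (fun i => u i + - (t.@[u] + 1) / b * v i).
by rewrite lineE divfK //; lra.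
Qed.

(** * The polynomials f and g in coordinates *)

Definition point3 (R : realType) (x y z : R) : 'I_3 -> R :=
  fun i => nth 0 [:: x; y; z] i.

Lemma eval_f (R : realType) (v : 'I_3 -> R) :
  (f R).@[v] = v 0 ^+ 3 * v 2 + v 0 ^+ 3 * v 1 + v 1 ^+ 2 * v 2 ^+ 2.
Proof. by rewrite /f !mevalD !mevalM !mevalXU; ring. Qed.

Lemma eval_g (R : realType) (v : 'I_3 -> R) :
  (g R).@[v] = v 0 * v 2 + v 1 * v 2 + v 0 * v 1.
Proof. by rewrite /g !mevalD !mevalM !mevalXU. Qed.

Lemma f_ge0_of_g_ge0 (R : realType) (x y z : R) :
  0 <= x * z + y * z + x * y ->
  0 <= x ^+ 3 * z + x ^+ 3 * y + y ^+ 2 * z ^+ 2.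
Proof.
move=> g_ge0; set p := y * z; set a := - (x * (y + z)).
have fE : x ^+ 3 * z + x ^+ 3 * y + y ^+ 2 * z ^+ 2 = p ^+ 2 - x ^+ 2 * a.
  by rewrite /p /a; ring.
have le_ap : a <= p by rewrite /p /a; lra.
have x2_ge0 : 0 <= x ^+ 2 := sqr_ge0 x.
rewrite fE; have [a_le0|a_gt0] := lerP a 0.
  by have := sqr_ge0 p; nra.
have a2_ge : 4 * p * x ^+ 2 <= a ^+ 2.
  have := sqr_ge0 (x * (y - z)).
  by rewrite /a /p; nra.
have : a ^+ 2 <= p ^+ 2 by rewrite ler_sqr ?nnegrE; lra.
by nra.
Qed.

(** * Exclusion of the multipliers *)

Lemma le0_of_le_linear (R : realFieldType) (A M : R) :
  (forall e, 0 < e -> e <= 1 -> A <= e * M) -> A <= 0.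
Proof.
move=> A_le; rewrite leNgt; apply/negP => A_gt0.
have M_gt0 : 0 < M by have := A_le 1 ltr01 (lexx 1); lra.
have d_gt0 : 0 < A + M by lra.
have := A_le (A / (A + M)).
rewrite divr_gt0 // ler_pdivrMr // mulrAC ler_pdivlMr //.
by move=> /(_ isT); nra.
Qed.

Section Multiplier.

Variables (R : realType) (t : {mpoly R[3]}).
Hypothesis t_ge0 : nonneg_poly t.
Hypothesis ftg_ge0 : forall y, 0 <= (f R).@[y] - t.@[y] * (g R).@[y].

Lemma multiplier_lower_bound : 1 <= t.@[point3 (-1) 1 1].
Proof.
have := ftg_ge0 (point3 (-1) 1 1).
by rewrite eval_f eval_g /point3 /=; lra.
Qed.

(** As e > 0 tends to 0, g is of order e and f of order e^2 at v + e w, so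
    t <= f / g tends to 0.  The factor 1 before v matches
    [dhomog2_eval_plane]. *)
Lemma multiplier_zero (v w : 'I_3 -> R) :
  t \is 2.-homog ->
  (forall e, (f R).@[fun i => 1 * v i + e * w i] = e ^+ 4 + e ^+ 3 + e ^+ 2) ->
  (forall e, (g R).@[fun i => 1 * v i + e * w i] = e ^+ 2 + 2 * e) ->
  t.@[v] = 0.
Proof.
move=> homt fE gE; have [b tE] := dhomog2_eval_plane v w homt.
apply/eqP; rewrite eq_le t_ge0 andbT.
(* At v + e w, t equals t(v) + e b + e^2 t(w) and is at most 3 e. *)
apply: (@le0_of_le_linear _ _ (3 + `|b|)) => e e_gt0 e_le1.
have := ftg_ge0 (fun i => 1 * v i + e * w i); rewrite fE gE.
have := t_ge0 (fun i => 1 * v i + e * w i).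
have tw_ge0 := t_ge0 w; have := tE 1 e.
set T := t.@[_] => TE T_ge0 ineq.
have T_le : T <= 3 * e.
  have : 0 <= e * (e ^+ 3 + e ^+ 2 + e - T * (e + 2)).
    by rewrite (_ : e * _ = e ^+ 4 + e ^+ 3 + e ^+ 2 - T * (e ^+ 2 + 2 * e));
      [|ring].
  rewrite pmulr_rge0 // => ineq'.
  have : e ^+ 2 <= e by nra.
  have : e ^+ 3 <= e by rewrite exprS; nra.
  by nra.
have := ler_norm (- b); rewrite normrN => b_le.
by nra.
Qed.

Lemma no_quadratic_multiplier : t \is 2.-homog -> False.
Proof.
move=> homt.
have te2 : t.@[point3 0 1 0] = 0.
  apply: (@multiplier_zero _ (point3 1 0 1)) => // e.
    by rewrite eval_f /point3 /=; ring.
  by rewrite eval_g /point3 /=; ring.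
have te3 : t.@[point3 0 0 1] = 0.
  apply: (@multiplier_zero _ (point3 1 1 0)) => // e.
    by rewrite eval_f /point3 /=; ring.
  by rewrite eval_g /point3 /=; ring.
have tE x y z : t.@[point3 x y z] = x ^+ 2 * t.@[point3 1 0 0].
  rewrite -(dhomog_eval_scale x _ homt).
  rewrite -[RHS](zero_in_radical _ y homt t_ge0 te2).
  rewrite -[RHS](zero_in_radical _ z homt t_ge0 te3).
  apply: meval_eq => -[[|[|[|//]]] ?]; rewrite /point3 /=; ring.
have := multiplier_lower_bound; have := ftg_ge0 (point3 2 1 1).
rewrite (tE 2) (tE (-1)) eval_f eval_g /point3 /=.
by lra.
Qed.

Lemma no_linear_multiplier : t \is 1.-homog -> False.
Proof.
move=> homt; have := t_ge0 (fun i => -1 * point3 (-1) 1 1 i).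
rewrite (dhomog_eval_scale _ _ homt).
by have := multiplier_lower_bound; lra.
Qed.

Lemma no_constant_multiplier : t \is 0.-homog -> False.
Proof.
move=> homt; have constE v : t.@[v] = t.@[fun i => 0 * v i].
  by rewrite (dhomog_eval_scale _ _ homt) expr0 mul1r.
have zeroE : t.@[point3 2^-1 1 2^-1] = t.@[point3 (-1) 1 1].
  by rewrite constE [RHS]constE; apply: meval_eq => i; rewrite !mul0r.
have := multiplier_lower_bound; have := ftg_ge0 (point3 2^-1 1 2^-1).
rewrite zeroE eval_f eval_g /point3 /=.
by lra.
Qed.

End Multiplier.

Theorem mainTheorem1 (R : realType) :
  [/\ exists x' : 'I_3 -> R, 0 < (g R).@[x'],
      nonneg_set (g R) `<=` nonneg_set (f R)
    & ~ exists t : {mpoly R[3]},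
          [/\ nonneg_poly t,
              exists2 d : nat, (d <= 2)%N & t \is d.-homog
            & forall y : 'I_3 -> R, 0 <= (f R).@[y] - t.@[y] * (g R).@[y]]].
Proof.
split.
- by exists (fun=> 1); rewrite eval_g; lra.
- move=> v; rewrite /nonneg_set /= eval_f eval_g.
  exact: f_ge0_of_g_ge0.
- move=> [t [t_ge0 [d d_le2 homt] ftg_ge0]].
  case: d d_le2 homt => [|[|[|//]]] _ homt.
  + exact: (no_constant_multiplier ftg_ge0 homt).
  + exact: (no_linear_multiplier t_ge0 ftg_ge0 homt).
  + exact: (no_quadratic_multiplier t_ge0 ftg_ge0 homt).
Qed.
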